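(* Let $(\mathfrak g,[-,-],R)$ be a Rota-Baxter Lie algebra of weight $\lambda$ over $\mathbf k$ and let $\{e_j\}_{j\in J}$ be a basis of $\mathfrak g$ such that there are $y_j\in\mathfrak g$ with $(\mathrm{ad}\,e_j)^p=\mathrm{ad}\,y_j$ for all $j\in J$. (1) There exists exactly one $p$-map $(-)^{[p]}:\mathfrak g\to\mathfrak g$ (making $\mathfrak g$ a restricted Lie algebra) such that $e_j^{[p]}=y_j$ for all $j\in J$. (2) Furthermore, if $R\big(e_j^{[p]_R}\big)=R(e_j)^{[p]}$ for all $j\in J$, then $(\mathfrak g,[-,-],(-)^{[p]},R)$ is a restricted Rota-Baxter Lie algebra of weight $\lambda$.
   Context: Convention: $\mathbf k$ is an algebraically closed field of prime characteristic $p$; everything is over $\mathbf k$. Restricted Lie algebra: a Lie algebra $(\mathfrak g,[-,-])$ with a $p$-map $(-)^{[p]}:\mathfrak g\to\mathfrak g$ satisfying $(ax)^{[p]}=a^px^{[p]}$ for $a\in\mathbf k$, $[x^{[p]},y]=(\mathrm{ad}_x)^p(y)$, and $(x+y)^{[p]}=x^{[p]}+y^{[p]}+\sum_{i=1}^{p-1}s_i(x,y)$, where $i\,s_i(x,y)$ is the coefficient of $t^{i-1}$ in $(\mathrm{ad}_{tx+y})^{p-1}(x)\in\mathbf k[t]\otimes\mathfrak g$. Rota-Baxter Lie algebra of weight $\lambda\in\mathbf k$: a Lie algebra $\mathfrak g$ with a linear map $R:\mathfrak g\to\mathfrak g$ such that $[R(x),R(y)]=R([R(x),y])+R([x,R(y)])+\lambda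 R([x,y])$ for all $x,y$. Put $x\rhd_Ry:=[R(x),y]$ and $x^{\rhd_Rk}:=x\rhd_R(x\rhd_R\cdots(x\rhd_Rx)\cdots)$ ($k$ copies of $x$, $x^{\rhd_R1}=x$). For a composition $\alpha=(\alpha_1,\dots,\alpha_r)\vDash n$ (a tuple of positive integers with sum $n$, of length $\ell(\alpha)=r$), $C_\alpha=\prod_{k=1}^r\binom{\alpha_1+\cdots+\alpha_k-1}{\alpha_k-1}$. Given a $p$-map $(-)^{[p]}$, define $$x^{[p]_R}:=\lambda^{p-1}x^{[p]}+\sum_{r=1}^{p-1}\frac1r\lambda^{r-1}\sum_{\alpha\vDash p,\ \ell(\alpha)=r}C_\alpha\,[x^{\rhd_R\alpha_1},[x^{\rhd_R\alpha_2},[\cdots[x^{\rhd_R\alpha_{r-1}},x^{\rhd_R\alpha_r}]\cdots]]]$$ ($\lambda^0=1$; $\frac1r$ is the inverse of $r$ modulo $p$). A restricted Rota-Baxter Lie algebra of weight $\lambda$ is a restricted Lie algebra with a Rota-Baxter operator $R$ of weight $\lambda$ satisfying $R(x^{[p]_R})=R(x)^{[p]}$ for all $x\in\mathfrak g$. *)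

(* Defs.v *)
From HB Require Import structures.
From mathcomp Require Import all_boot all_order all_algebra.

Set Implicit Arguments.
Unset Strict Implicit.
Unset Printing Implicit Defensive.

Import GRing.Theory.

Local Open Scope ring_scope.

(* A basis indexed by an arbitrary, possibly infinite, type J; finite
   subfamilies are given by (injective) maps from ordinals to J. *)
Definition lin_indep (k : fieldType) (g : lmodType k) (J : Type)
    (e : J -> g) : Prop :=
  forall (n : nat) (f : 'I_n -> J) (c : 'I_n -> k), injective f ->
    \sum_(i < n) c i *: e (f i) = 0 -> forall i, c i = 0.

Definition spanning (k : fieldType) (g : lmodType k) (J : Type)
    (e : J -> g) : Prop :=
  forall x : g, exists (n : nat) (f : 'I_n -> J) (c : 'I_n -> k),
    x = \sum_(i < n) c i *: e (f i).

Definition is_basis (k : fieldType) (g : lmodType k) (J : Type)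
    (e : J -> g) : Prop :=
  lin_indep e /\ spanning e.

Record is_lie_bracket (k : fieldType) (g : lmodType k)
    (br : g -> g -> g) : Prop := IsLieBracket {
  lie_linear_l : forall y, linear (fun x => br x y);
  lie_linear_r : forall x, linear (br x);
  lie_alt : forall x, br x x = 0;
  lie_jacobi : forall x y z,
    br x (br y z) + br y (br z x) + br z (br x y) = 0
}.

Definition ad (T : Type) (br : T -> T -> T) (x : T) : T -> T := br x.

(* Elements of k[t] (x) g are represented by their coefficients: the function
   u : nat -> g stands for the sum of the t^n (x) u n.  Finite support is not
   recorded, as only polynomials are produced in the definition of jac_s. *)
Definition poly_bracket (k : fieldType) (g : lmodType k)
    (br : g -> g -> g) (u v : nat -> g) : nat -> g :=
  fun n => \sum_(i < n.+1) br (u i) (v (n - i)%N).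

Definition poly_cst (k : fieldType) (g : lmodType k) (x : g) : nat -> g :=
  fun n => if n is 0 then x else 0.

(* t x + y *)
Definition poly_lin (k : fieldType) (g : lmodType k) (x y : g) : nat -> g :=
  fun n => match n with 0 => y | 1 => x | _ => 0 end.

(* i * s_i(x, y) is the coefficient of t^(i-1) in (ad (t x + y))^(p-1) (x);
   only used for 0 < i < p, where i is invertible in k. *)
Definition jac_s (k : fieldType) (g : lmodType k) (p : nat)
    (br : g -> g -> g) (i : nat) (x y : g) : g :=
  (i%:R : k)^-1 *:
    iter p.-1 (ad (poly_bracket br) (poly_lin x y)) (poly_cst x) i.-1.

Record is_pmap (k : fieldType) (g : lmodType k) (p : nat)
    (br : g -> g -> g) (pm : g -> g) : Prop := IsPmap {
  pmapZ : forall (a : k) (x : g), pm (a *: x) = a ^+ p *: pm x;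
  pmap_ad : forall x y, br (pm x) y = iter p (ad br x) y;
  pmapD : forall x y,
    pm (x + y) = pm x + pm y + \sum_(1 <= i < p) jac_s p br i x y
}.

Definition is_restricted_lie (k : fieldType) (g : lmodType k) (p : nat)
    (br : g -> g -> g) (pm : g -> g) : Prop :=
  is_lie_bracket br /\ is_pmap p br pm.

Definition is_rota_baxter (k : fieldType) (g : lmodType k) (lambda : k)
    (br : g -> g -> g) (R : {linear g -> g}) : Prop :=
  forall x y : g,
    br (R x) (R y) = R (br (R x) y) + R (br x (R y)) + lambda *: R (br x y).

Definition is_rota_baxter_lie (k : fieldType) (g : lmodType k) (lambda : k)
    (br : g -> g -> g) (R : {linear g -> g}) : Prop :=
  is_lie_bracket br /\ is_rota_baxter lambda br R.

Definition rb_prod (k : fieldType) (g : lmodType k)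
    (br : g -> g -> g) (R : g -> g) (x y : g) : g := br (R x) y.

(* The right-nested product of n copies of x (n > 0). *)
Definition rb_power (k : fieldType) (g : lmodType k)
    (br : g -> g -> g) (R : g -> g) (x : g) (n : nat) : g :=
  iter n.-1 (rb_prod br R x) x.

Definition is_composition (n : nat) (a : seq nat) : bool :=
  all (leq 1) a && (sumn a == n).

Definition comp_coef (a : seq nat) : nat :=
  (\prod_(i < size a) 'C((sumn (take i.+1 a)).-1, (nth 0 a i).-1))%N.

(* [x1, [x2, [..., [x_(r-1), x_r]...]]]; a one-term sequence gives x1. *)
Fixpoint nested_bracket (k : fieldType) (g : lmodType k)
    (br : g -> g -> g) (s : seq g) : g :=
  match s with
  | [::] => 0
  | [:: x] => x
  | x :: s' => br x (nested_bracket br s')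
  end.

(* Compositions of p of length r are r-tuples with entries in 'I_p.+1, since
   every part is at most p. *)
Definition rb_pmap (k : fieldType) (g : lmodType k) (p : nat) (lambda : k)
    (br : g -> g -> g) (R : g -> g) (pm : g -> g) (x : g) : g :=
  lambda ^+ p.-1 *: pm x +
  \sum_(1 <= r < p) ((r%:R : k)^-1 * lambda ^+ r.-1) *:
    \sum_(a : r.-tuple 'I_p.+1 | is_composition p (map val a))
      (comp_coef (map val a))%:R *:
        nested_bracket br [seq rb_power br R x (val i) | i <- a].

Record is_restricted_rota_baxter_lie (k : fieldType) (g : lmodType k)
    (p : nat) (lambda : k) (br : g -> g -> g) (pm : g -> g)
    (R : {linear g -> g}) : Prop := IsRestrictedRotaBaxterLie {
  rrb_restricted : is_restricted_lie p br pm;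
  rrb_rota_baxter : is_rota_baxter lambda br R;
  rrb_compat : forall x : g, R (rb_pmap p lambda br R pm x) = pm (R x)
}.

(* Main.v *)
Require Import Defs.
From HB Require Import structures.
From mathcomp Require Import all_boot all_order all_algebra.
From mathcomp Require Import boolp functions.

(* Write [S x y] for the sum of the Jacobson polynomials [s_i x y].  The idea
   is that [S] integrates the 1-form [u |-> (ad u)^(p-1)] along the segment
   from [y] to [x + y], and that this form is closed in every Lie algebra of
   characteristic [p].  Working with power series over [g] and with the dual
   numbers g[eps], closedness shows that [S] is a symmetric 2-cocycle and that
   [ad (S x y) = ad (x + y)^p - (ad x)^p - (ad y)^p].  No enveloping algebra is
   needed.  The cocycle defines an extension of [g] by its Frobenius twist, and
   p-maps are linear sections of this extension, hence are determined, and can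
   be prescribed, on a basis.

   For the second part, the composition sum in [x^[p]_R] is an expansion of
   [s_r x (R x)], so that
     x^[p]_R = lambda^(p-1) x^[p] + sum_r lambda^(r-1) s_r x (R x),
   which is [((lambda x + R x)^[p] - (R x)^[p]) / lambda] if [lambda != 0] and
   [(ad (R x))^(p-1) x] if [lambda = 0].  In both cases [x |-> x^[p]_R] satisfies
   Jacobson's formula for the descendent bracket, from which [R] is a morphism
   to [br]; therefore the compatibility condition is stable under sums. *)

Set Implicit Arguments.
Unset Strict Implicit.
Unset Printing Implicit Defensive.

Import GRing.Theory.
Local Open Scope ring_scope.


(** * Bilinear products and their iterates *)

Section Bilinear.
Variables (k : fieldType) (g : lmodType k) (br : g -> g -> g).
Hypothesis linl : forall y, linear (fun x => br x y).
Hypothesis linr : forall x, linear (br x).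

Lemma bil0l y : br 0 y = 0.
Proof. by have /(_ (-1) 0 0) := linl y; rewrite scaler0 addr0 scaleN1r addNr. Qed.

Lemma bil0r x : br x 0 = 0.
Proof. by have := linr x (-1) 0 0; rewrite scaler0 addr0 scaleN1r addNr. Qed.

Lemma bilDl x y z : br (x + y) z = br x z + br y z.
Proof. by have := linl z 1 x y; rewrite !scale1r. Qed.

Lemma bilDr x y z : br x (y + z) = br x y + br x z.
Proof. by have := linr x 1 y z; rewrite !scale1r. Qed.

Lemma bilZl a x y : br (a *: x) y = a *: br x y.
Proof. by have := linl y a x 0; rewrite !addr0 bil0l addr0. Qed.

Lemma bilZr a x y : br x (a *: y) = a *: br x y.
Proof. by have := linr x a y 0; rewrite !addr0 bil0r addr0. Qed.

Lemma bilNr x y : br x (- y) = - br x y.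
Proof. by rewrite -scaleN1r bilZr scaleN1r. Qed.

Lemma bil_suml I r (P : pred I) (F : I -> g) y :
  br (\sum_(i <- r | P i) F i) y = \sum_(i <- r | P i) br (F i) y.
Proof. by apply: (big_morph (br^~ y)) => [a b|]; rewrite ?bilDl ?bil0l. Qed.

Lemma bil_sumr I r (P : pred I) (F : I -> g) x :
  br x (\sum_(i <- r | P i) F i) = \sum_(i <- r | P i) br x (F i).
Proof. by apply: (big_morph (br x)) => [a b|]; rewrite ?bilDr ?bil0r. Qed.

Lemma bil_iterZ n u a x : iter n (br u) (a *: x) = a *: iter n (br u) x.
Proof. by elim: n => //= n ->; rewrite bilZr. Qed.

Lemma bil_iterZl n u a x : iter n (br (a *: u)) x = a ^+ n *: iter n (br u) x.
Proof.
by elim: n => [|n IH] /=; rewrite ?expr0 ?scale1r // IH bilZl bilZr scalerA exprS.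
Qed.

Lemma bil_iter0 n u : iter n (br u) 0 = 0.
Proof. by elim: n => //= n ->; rewrite bil0r. Qed.

(** A discrete Duhamel formula: an inhomogeneous linear recurrence is unrolled, and [i] counts the
    steps made after the forcing term enters. *)
Lemma bil_iter_rec u v w (E : nat -> g) :
  (forall n, E n.+1 = br u (E n) + br v (iter n (br u) w)) ->
  forall n, E n = iter n (br u) (E 0) +
    \sum_(i < n) iter i (br u) (br v (iter (n.-1 - i) (br u) w)).
Proof.
move=> HE; elim=> [|n IH]; first by rewrite big_ord0 addr0.
rewrite HE {}IH bilDr -addrA big_ord_recl /= subn0 [X in _ = _ + X]addrC.
congr (_ + (_ + _)); rewrite bil_sumr; apply: eq_bigr => -[i Hi] _ /=.
by rewrite /bump /= -subn1 -subnDA.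
Qed.

End Bilinear.

(** * Identities in Lie algebras of characteristic [p] *)

Section Lie.
Variables (k : fieldType) (g : lmodType k) (br : g -> g -> g).
Hypothesis hL : is_lie_bracket br.

Lemma lieC x y : br x y = - br y x.
Proof.
case: hL => l r a _; apply/eqP; rewrite -addr_eq0 addrC; apply/eqP.
by have := a (x + y); rewrite (bilDl l) !(bilDr r) !a add0r addr0 addrC.
Qed.

Lemma lie_leibniz x y z : br x (br y z) = br (br x y) z + br y (br x z).
Proof.
case: hL => l r a J; have := J x y z.
rewrite (lieC z x) (bilNr r) (lieC z (br x y)) => /eqP.
by rewrite subr_eq0 => /eqP <-; rewrite addrNK.
Qed.

Variables (p : nat).
Hypothesis hp : p \in [pchar k].

(** By the Leibniz rule and Pascal's rule, the right-hand side obeys the recurrence whose unrolling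
    is the left-hand side. *)
Lemma lie_hockey u v w n :
  \sum_(i < n) iter i (br u) (br v (iter (n.-1 - i) (br u) w)) =
  \sum_(i < n) 'C(n, i.+1)%:R *: br (iter i (br u) v) (iter (n.-1 - i) (br u) w).
Proof.
case: (hL) => l r a J.
pose E n := \sum_(i < n)
  'C(n, i.+1)%:R *: br (iter i (br u) v) (iter (n.-1 - i) (br u) w).
suff HE m : E m.+1 = br u (E m) + br v (iter m (br u) w).
  by rewrite -/(E n) (bil_iter_rec r HE) /E big_ord0 (bil_iter0 r) add0r.
rewrite /E (bil_sumr r).
under [in RHS]eq_bigr => i _ do rewrite (bilZr r) lie_leibniz scalerDr.
rewrite big_split /=.
under [in LHS]eq_bigr => i _ do rewrite binS natrD scalerDl.
rewrite big_split /= -addrA addrCA; congr (_ + _).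
  rewrite big_ord_recr /= bin_small // scale0r addr0.
  apply: eq_bigr => -[i Hi] _ /=; congr (_ *: br _ _).
  by rewrite -iterS; congr iter; case: m Hi => // m Hi; rewrite subSn.
rewrite big_ord_recl /= bin0 scale1r subn0 addrC; congr (_ + _).
apply: eq_bigr => -[i Hi] _ /=; congr (_ *: br _ (iter _ _ _)).
by rewrite /bump /= -subn1 -subnDA.
Qed.

(* The 1-form [u |-> (ad u)^(p-1)] on [g] is closed: its exterior derivative
   at [u] is the difference of the two sides. *)
Lemma lie_closed u v w :
  \sum_(i < p.-1) iter i (br u) (br v (iter (p.-2 - i) (br u) w)) =
  \sum_(i < p.-1) iter i (br u) (br w (iter (p.-2 - i) (br u) v)).
Proof.
have pP := pcharf_prime hp.
(* Reversing the index on the right and using antisymmetry matches the brackets; the binomial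
   coefficients remain to be compared. *)
rewrite !lie_hockey [in RHS](reindex_inj rev_ord_inj) /=.
apply: eq_bigr => -[i Hi] _ /=; rewrite -[br (iter _ _ w) _]opprK -lieC.
have -> : (p.-2 - (p.-1 - i.+1) = i)%N.
  by case: p Hi => [|[|q]] //= Hi; rewrite subSS subKn // -ltnS.
have -> : (p.-1 - i.+1 = p.-2 - i)%N by case: p Hi => [|[|q]] //=; rewrite subSS.
rewrite scalerN -scaleNr; congr (_ *: _); apply/eqP.
have -> : (p.-2 - i).+1 = (p.-1 - i)%N.
  by case: p Hi => [|[|q]] //= Hi; rewrite subSn // -ltnS.
rewrite bin_sub; last exact: ltnW.
(* The two coefficients add up to ['C(p, i.+1)], which [p] divides. *)
rewrite -addr_eq0 -natrD -binS prednK ?prime_gt0 //.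
by rewrite -(dvdn_pcharf hp) prime_dvd_bin // -ltn_predRL.
Qed.

End Lie.


(** * Power series over [g]: bracket, derivative, evaluation *)

Lemma series_addE (k : fieldType) (g : lmodType k) (u v : nat -> g) n :
  (u + v) n = u n + v n.
Proof. by []. Qed.

Lemma series_scaleE (k : fieldType) (g : lmodType k) a (u : nat -> g) n :
  (a *: u) n = a *: u n.
Proof. by []. Qed.

Section Series.
Variables (k : fieldType) (g : lmodType k) (br : g -> g -> g).
Hypothesis linl : forall y, linear (fun x => br x y).
Hypothesis linr : forall x, linear (br x).

Local Notation PB := (poly_bracket br).

(** The common bound [N] makes the index ranges independent, so that sums can be exchanged. *)
Lemma poly_bracketE N (u v : nat -> g) n : (n < N)%N ->
  PB u v n = \sum_(i < N) \sum_(j < N | (i + j == n)%N) br (u i) (v j).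
Proof.
move=> nN; rewrite /poly_bracket (big_ord_widen N (fun i => br (u i) (v (n - i)%N))) //.
rewrite big_mkcond /=; apply: eq_bigr => i _; rewrite ltnS; case: leqP => Hi.
  have Hj : (n - i < N)%N by apply: leq_ltn_trans nN; apply: leq_subr.
  rewrite (big_pred1 (Ordinal Hj)) // => j /=.
  by rewrite -val_eqE /= -[in RHS](eqn_add2l i) subnKC.
rewrite big_pred0 // => j; apply/negbTE; rewrite neq_ltn; apply/orP; right.
by apply: leq_trans Hi _; apply: leq_addr.
Qed.

Lemma poly_bracket3E N (u v w : nat -> g) n : (n < N)%N ->
  PB u (PB v w) n = \sum_(i < N) \sum_(j < N) \sum_(l < N)
    if (i + j + l == n)%N then br (u i) (br (v j) (w l)) else 0.
Proof.
move=> nN; rewrite (poly_bracketE _ _ nN); apply: eq_bigr => i _.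
transitivity (\sum_(m < N | (i + m == n)%N) \sum_(j < N)
    \sum_(l < N | (j + l == m)%N) br (u i) (br (v j) (w l))).
  apply: eq_bigr => m _; rewrite (@poly_bracketE N) // (bil_sumr linr).
  by apply: eq_bigr => j _; rewrite (bil_sumr linr).
rewrite exchange_big /=; apply: eq_bigr => j _; rewrite -big_mkcond /=.
rewrite (exchange_big_dep (fun l : 'I_N => i + j + l == n)%N) /=; last first.
  by move=> m l /eqP <- /eqP <-; rewrite addnA.
apply: eq_bigr => l /eqP Hl.
have HN : (j + l < N)%N by apply: leq_ltn_trans nN; rewrite -Hl -addnA leq_addl.
rewrite (big_pred1 (Ordinal HN)) // => m /=; rewrite -val_eqE /=.
by apply/andP/eqP => [[_ /eqP <-] //|->]; rewrite addnA Hl !eqxx.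
Qed.

Lemma poly_bracket_linl (v : nat -> g) : linear (fun u => PB u v : nat -> g).
Proof.
move=> a x y; apply/funext => n; rewrite series_addE series_scaleE /poly_bracket.
rewrite scaler_sumr -big_split /=; apply: eq_bigr => i _.
by rewrite series_addE series_scaleE (bilDl linl) (bilZl linl).
Qed.

Lemma poly_bracket_linr (u : nat -> g) : linear (PB u : (nat -> g) -> nat -> g).
Proof.
move=> a x y; apply/funext => n; rewrite series_addE series_scaleE /poly_bracket.
rewrite scaler_sumr -big_split /=; apply: eq_bigr => i _.
by rewrite series_addE series_scaleE (bilDr linr) (bilZr linr).
Qed.

Definition series_deriv (u : nat -> g) : nat -> g := fun n => n.+1%:R *: u n.+1.

Lemma series_deriv_linear : linear series_deriv.
Proof.
move=> a x y; apply/funext => n.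
by rewrite /series_deriv !series_addE !series_scaleE scalerDr !scalerA [a * _]mulrC.
Qed.

Lemma series_deriv_bracket u v :
  series_deriv (PB u v) = PB (series_deriv u) v + PB u (series_deriv v).
Proof.
apply/funext => n; rewrite series_addE /series_deriv /poly_bracket scaler_sumr.
transitivity (\sum_(i < n.+2) (i%:R *: br (u i) (v (n.+1 - i)%N) +
   (n.+1 - i)%:R *: br (u i) (v (n.+1 - i)%N))).
  apply: eq_bigr => -[i Hi] _ /=.
  by rewrite -scalerDl -natrD subnKC.
rewrite big_split /= big_ord_recl /= scale0r add0r; congr (_ + _).
  by apply: eq_bigr => i _; rewrite (bilZl linl) /bump /= subSS.
rewrite big_ord_recr /= subnn scale0r addr0.
by apply: eq_bigr => -[i Hi] _ /=; rewrite subSn // (bilZr linr).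
Qed.

(* A series of degree at most [d] is read as the homogeneous form
   [sum_n u_n X^n Y^(d-n)]; the points (1,1), (1,0) and (0,1) give the value
   at 1, the top coefficient and the constant coefficient. *)
Definition deg_le (d : nat) (u : nat -> g) := forall n, (d < n)%N -> u n = 0.

Definition form_eval (a b : k) (d : nat) (u : nat -> g) : g :=
  \sum_(n < d.+1) (a ^+ n * b ^+ (d - n)) *: u n.

Lemma form_eval_linear a b d : linear (form_eval a b d).
Proof.
move=> c x y; rewrite /form_eval scaler_sumr -big_split /=; apply: eq_bigr => i _.
by rewrite series_addE series_scaleE scalerDr !scalerA [c * _]mulrC.
Qed.

Lemma form_eval_widen a b d N u : deg_le d u -> (d < N)%N ->
  form_eval a b d u = \sum_(n < N) (a ^+ n * b ^+ (d - n)) *: u n.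
Proof.
move=> Hu HN; rewrite /form_eval.
rewrite (big_ord_widen N (fun n => (a ^+ n * b ^+ (d - n)) *: u n)) //.
rewrite big_mkcond /=; apply: eq_bigr => i _; rewrite ltnS.
by case: leqP => // /Hu ->; rewrite scaler0.
Qed.

Lemma deg_le_bracket d1 d2 u v : deg_le d1 u -> deg_le d2 v ->
  deg_le (d1 + d2) (PB u v).
Proof.
move=> Hu Hv n Hn; rewrite /poly_bracket big1 // => i _.
case: (leqP i d1) => Hi; last by rewrite Hu // (bil0l linl).
rewrite Hv ?(bil0r linr) // ltn_subRL.
by apply: leq_ltn_trans Hn; rewrite leq_add2r.
Qed.

(** The exponents of [a] and of [b] add up in a product of forms; the declared degrees fix those of
    [b]. *)
Lemma form_eval_bracket a b d1 d2 u v : deg_le d1 u -> deg_le d2 v ->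
  form_eval a b (d1 + d2) (PB u v) =
  br (form_eval a b d1 u) (form_eval a b d2 v).
Proof.
move=> Hu Hv; pose N := (d1 + d2).+1.
have H1 : (d1 < N)%N by rewrite ltnS leq_addr.
have H2 : (d2 < N)%N by rewrite ltnS leq_addl.
rewrite (form_eval_widen a b Hu H1) (form_eval_widen a b Hv H2).
rewrite (bil_suml linl) /form_eval -/N.
transitivity (\sum_(n < N) \sum_(i < N) \sum_(j < N | (i + j == n)%N)
    (a ^+ n * b ^+ (d1 + d2 - n)) *: br (u i) (v j)).
  apply: eq_bigr => n _; rewrite (@poly_bracketE N) // scaler_sumr.
  by apply: eq_bigr => i _; rewrite scaler_sumr.
rewrite exchange_big /=; apply: eq_bigr => i _; rewrite (bil_sumr linr).
rewrite (exchange_big_dep predT) //=; apply: eq_bigr => j _.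
rewrite (bilZl linl) (bilZr linr) scalerA.
case: (leqP i d1) => Hi; last first.
  by rewrite Hu // (bil0l linl) scaler0 big1 // => n _; rewrite scaler0.
case: (leqP j d2) => Hj; last first.
  by rewrite Hv // (bil0r linr) scaler0 big1 // => n _; rewrite scaler0.
have HN : (i + j < N)%N by rewrite ltnS leq_add.
rewrite (big_pred1 (Ordinal HN)) => [|n]; last by rewrite /= -val_eqE eq_sym.
congr (_ *: _); rewrite /= mulrACA -!exprD; congr (_ * _ ^+ _).
by rewrite addnBA // addnBAC // subnDA.
Qed.

Lemma deg_le_lin (x y : g) : deg_le 1 (poly_lin x y).
Proof. by case=> [|[]]. Qed.

Lemma form_eval_lin a b (x y : g) :
  form_eval a b 1 (poly_lin x y) = a *: x + b *: y.
Proof.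
by rewrite /form_eval !big_ord_recl big_ord0 /= !expr0 !expr1 mul1r mulr1 addr0 addrC.
Qed.

Lemma deg_le_iter n x y u : deg_le 1 u ->
  deg_le n.+1 (iter n (PB (poly_lin x y)) u).
Proof.
move=> Hu; elim: n => //= n IH.
by apply: (@deg_le_bracket 1 n.+1) => //; apply: deg_le_lin.
Qed.

Lemma form_eval_iter a b n x y u : deg_le 1 u ->
  form_eval a b n.+1 (iter n (PB (poly_lin x y)) u) =
  iter n (br (a *: x + b *: y)) (form_eval a b 1 u).
Proof.
move=> Hu; elim: n => //= n IH; rewrite (@form_eval_bracket a b 1 n.+1) //.
- by rewrite form_eval_lin IH.
- exact: deg_le_lin.
- exact: deg_le_iter.
Qed.

Variables (p : nat).
Hypothesis hp : p \in [pchar k].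

(* The fundamental theorem of calculus: the left-hand side is the formal
   integral of the derivative of [u] from 0 to 1, without the monomial of
   degree [p], whose derivative vanishes. *)
Lemma form_eval_deriv u : deg_le p u ->
  \sum_(1 <= i < p) (i%:R : k)^-1 *: series_deriv u i.-1 =
  form_eval 1 1 p u - form_eval 1 0 p u - form_eval 0 1 p u.
Proof.
move=> Hu; have pP := pcharf_prime hp.
have -> : form_eval 1 0 p u = u p.
  rewrite /form_eval big_ord_recr /= subnn mulr1 expr1n scale1r big1 ?add0r //.
  by move=> i _; rewrite expr0n subn_eq0 leqNgt ltn_ord /= mulr0 scale0r.
have -> : form_eval 0 1 p u = u 0.
  rewrite /form_eval big_ord_recl /= expr1n mulr1 expr0 scale1r big1 ?addr0 //.
  by move=> i _; rewrite expr0n /= mul0r scale0r.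
have -> : form_eval 1 1 p u = \sum_(0 <= i < p.+1) u i.
  by rewrite big_mkord; apply: eq_bigr => i _; rewrite !expr1n mulr1 scale1r.
rewrite big_nat_recr //= addrK [in RHS]big_ltn ?prime_gt0 // [u 0 + _]addrC addrK.
apply: eq_big_nat => -[//|i] /andP[_ Hi].
rewrite /series_deriv /= scalerA mulVf ?scale1r //.
by rewrite -(dvdn_pcharf hp) gtnNdvd.
Qed.

End Series.

Lemma sum3_rot (V : nmodType) N (F : 'I_N -> 'I_N -> 'I_N -> V) :
  \sum_i \sum_j \sum_l F i j l = \sum_j \sum_l \sum_i F i j l.
Proof. by rewrite exchange_big /=; apply: eq_bigr => j _; exact: exchange_big. Qed.

Lemma poly_bracket_lie (k : fieldType) (g : lmodType k) (br : g -> g -> g) :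
  is_lie_bracket br -> is_lie_bracket (poly_bracket br : (nat -> g) -> _ -> _).
Proof.
move=> hL; case: (hL) => l r alt J; split.
- exact: poly_bracket_linl.
- exact: poly_bracket_linr.
- move=> u; apply/funext => n; rewrite (poly_bracketE _ _ _ (ltnSn n)).
  (* Diagonal terms vanish, and the terms below the diagonal cancel those above it. *)
  rewrite pair_big_dep /= (bigID (fun q : 'I_n.+1 * 'I_n.+1 => q.1 < q.2)%N) /= addrC.
  rewrite (bigID (fun q => q.1 == q.2)) /= big1 ?add0r; last first.
    by move=> q /andP[_ /eqP ->]; rewrite alt.
  rewrite (reindex_inj (h := fun q : 'I_n.+1 * 'I_n.+1 => (q.2, q.1))) /=; last first.
    by move=> [a b] [c d] [-> ->].
  rewrite [X in _ + X = _](_ : _ = - \sum_(q : 'I_n.+1 * 'I_n.+1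
      | (q.1 + q.2 == n)%N && (q.1 < q.2)%N) br (u q.2) (u q.1)); last first.
    by rewrite -sumrN; apply: eq_bigr => q _; rewrite (lieC hL).
  apply/eqP; rewrite subr_eq0; apply/eqP; apply: eq_bigl => q.
  by rewrite addnC -andbA -leqNgt; congr andb; rewrite ltn_neqAle andbC eq_sym -val_eqE.
- move=> u v w; apply/funext => n; rewrite !series_addE.
  rewrite !(poly_bracket3E r _ _ _ (ltnSn n)).
  (* Rotating the order of summation aligns the three triple sums, so that Jacobi applies
     termwise. *)
  rewrite -[X in _ + X + _](sum3_rot (fun i j l => if (j + l + i == n)%N
    then br (v j) (br (w l) (u i)) else 0)).
  rewrite [X in _ + _ + X](sum3_rot (fun l i j => if (l + i + j == n)%N
    then br (w l) (br (u i) (v j)) else 0)) /=.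
  rewrite -!big_split big1 // => i _; rewrite -!big_split big1 // => j _.
  rewrite -!big_split big1 // => l' _ /=.
  have -> : (j + l' + i = i + j + l')%N by rewrite addnC addnA.
  have -> : (l' + i + j = i + j + l')%N by rewrite -addnA addnC.
  by case: eqP => _; rewrite ?addr0 ?J.
Qed.


(** * Jacobson polynomials: naturality, differential, cocycle identities *)

Definition jac_sum (k : fieldType) (g : lmodType k) (p : nat)
    (br : g -> g -> g) (x y : g) : g :=
  \sum_(1 <= i < p) jac_s p br i x y.

Definition lin_of (k : fieldType) (g h : lmodType k) (f : g -> h)
    (hf : linear f) : {linear g -> h} :=
  HB.pack f (GRing.isLinear.Build k g h *:%R f hf).

Section Naturality.
Variables (k : fieldType) (g h : lmodType k).
Variables (br : g -> g -> g) (br' : h -> h -> h) (f : {linear g -> h}).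
Hypothesis f_br : forall x y, f (br x y) = br' (f x) (f y).

(** Among the morphisms to which this is applied are the graphs [(v, D v)] of derivations [D], with
    values in the dual numbers. *)
Lemma jac_s_morph p i x y : f (jac_s p br i x y) = jac_s p br' i (f x) (f y).
Proof.
rewrite /jac_s linearZ /=; congr (_ *: _); move: (i.-1) => {}i.
elim: p.-1 i => [|n IH] i /=; first by case: i => //=; rewrite linear0.
rewrite /ad /poly_bracket linear_sum; apply: eq_bigr => j _; rewrite f_br IH.
by case: (val j) => [|[|m]] //=; rewrite linear0.
Qed.

Lemma jac_sum_morph p x y : f (jac_sum p br x y) = jac_sum p br' (f x) (f y).
Proof. by rewrite linear_sum; apply: eq_bigr => i _; rewrite jac_s_morph. Qed.

End Naturality.

(* The bracket of g[eps], eps^2 = 0. *)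
Definition dual_br (k : fieldType) (g : lmodType k) (br : g -> g -> g)
    (X Y : g * g) : g * g :=
  (br X.1 Y.1, br X.1 Y.2 + br X.2 Y.1).

Section Jacobson.
Variables (k : fieldType) (p : nat).
Hypothesis hp : p \in [pchar k].

Let p_gt0 : (0 < p)%N. Proof. exact: prime_gt0 (pcharf_prime hp). Qed.
Let p1_gt0 : (0 < p.-1)%N.
Proof. by rewrite -subn1 subn_gt0; apply: prime_gt1 (pcharf_prime hp). Qed.

Lemma series_deriv_lin (g : lmodType k) (x y : g) :
  series_deriv (poly_lin x y) = poly_cst x.
Proof.
by apply/funext => -[|[|n]]; rewrite /series_deriv /= ?scale1r ?scaler0.
Qed.

(* Along dual numbers this is the differential of the Jacobson polynomial: it
   is a primitive of a closed 1-form. *)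
Lemma jac_sum_dual (g : lmodType k) (br : g -> g -> g) x y a b :
  is_lie_bracket br ->
  (jac_sum p (dual_br br) (x, a) (y, b)).2 =
  iter p.-1 (br (x + y)) (a + b) - iter p.-1 (br x) a - iter p.-1 (br y) b.
Proof.
move=> hL; case: (hL) => l r _ _.
have PL := poly_bracket_lie hL; case: (PL) => Pl Pr _ _.
pose u := poly_lin x y; pose d := poly_lin a b.
pose E n : nat -> g * g :=
  iter n (ad (poly_bracket (dual_br br)) (poly_lin (x, a) (y, b))) (poly_cst (x, a)).
have fst_sum I s (F : I -> g * g) : (\sum_(i <- s) F i).1 = \sum_(i <- s) (F i).1.
  exact: (big_morph fst).
have snd_sum I s (F : I -> g * g) : (\sum_(i <- s) F i).2 = \sum_(i <- s) (F i).2.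
  exact: (big_morph snd).
have lin1 i : (poly_lin (x, a) (y, b) i).1 = u i by case: i => [|[]].
have lin2 i : (poly_lin (x, a) (y, b) i).2 = d i by case: i => [|[]].
have E1 n : (fun i => (E n i).1) = iter n (poly_bracket br u) (poly_cst x).
  elim: n => [|n IH]; apply/funext => i /=; first by case: i.
  rewrite -IH /ad /poly_bracket fst_sum; apply: eq_bigr => j _ /=.
  by rewrite lin1.
pose e n : nat -> g := fun i => (E n i).2.
have E2 n : e n.+1 = poly_bracket br u (e n) +
    poly_bracket br d (iter n (poly_bracket br u) (poly_cst x)).
  apply/funext => i; rewrite -E1 /e /= /ad series_addE /poly_bracket snd_sum.
  by rewrite -big_split; apply: eq_bigr => j _ /=; rewrite lin1 lin2.
have D2 n : series_deriv (iter n.+1 (poly_bracket br u) d) =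
    poly_bracket br u (series_deriv (iter n (poly_bracket br u) d)) +
    poly_bracket br (poly_cst x) (iter n (poly_bracket br u) d).
  by rewrite /= (series_deriv_bracket l r) series_deriv_lin addrC.
(* Both sides unroll by [bil_iter_rec]; the two sums differ by an exchange of [d] and [poly_cst x],
   which is [lie_closed] for series. *)
have ED : e p.-1 = series_deriv (iter p.-1 (poly_bracket br u) d).
  rewrite (bil_iter_rec Pr E2).
  rewrite (bil_iter_rec Pr
    (E := fun n => series_deriv (iter n (poly_bracket br u) d)) D2).
  rewrite /= series_deriv_lin (lie_closed PL hp); congr (_ + _).
  by congr (iter _ _ _); apply/funext => -[].
have degD : deg_le p (iter p.-1 (poly_bracket br u) d).
  by rewrite -[p in deg_le p](prednK p_gt0); apply: (deg_le_iter l r); apply: deg_le_lin.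
transitivity (\sum_(1 <= i < p) (i%:R : k)^-1 *: e p.-1 i.-1).
  by rewrite /jac_sum snd_sum; apply: eq_bigr.
rewrite ED (form_eval_deriv hp degD).
have FE s t : form_eval s t p (iter p.-1 (poly_bracket br u) d) =
    iter p.-1 (br (s *: x + t *: y)) (s *: a + t *: b).
  rewrite -[p in form_eval _ _ p](prednK p_gt0) (form_eval_iter l r).
    by rewrite form_eval_lin.
  exact: deg_le_lin.
by rewrite !FE !scale1r !scale0r !addr0 !add0r.
Qed.

Variables (g : lmodType k) (br : g -> g -> g).
Hypothesis hL : is_lie_bracket br.

Local Notation S := (jac_sum p br).
Local Notation PB := (poly_bracket br).

(** Already the first application of [ad (t x + y)] to [x] gives zero. *)
Lemma jac_sum_commuting x y : br y x = 0 -> S x y = 0.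
Proof.
case: (hL) => l r alt _ yx; rewrite /jac_sum big1 // => i _.
rewrite /jac_s -(prednK p1_gt0) iterSr.
have -> : ad PB (poly_lin x y) (poly_cst x) = 0.
  apply/funext => n; rewrite /ad /poly_bracket big1 // => -[j Hj] _ /=.
  case: j Hj => [|[|j]] Hj /=; last exact: (bil0l l).
    by case: (n - 0)%N => //= m; rewrite (bil0r r).
  by case: (n - 1)%N => //= m; rewrite (bil0r r).
rewrite (bil_iter0 (br := PB)) ?scaler0 //; exact: poly_bracket_linr.
Qed.

Lemma jac_sum0r x : S x 0 = 0.
Proof. by apply: jac_sum_commuting; case: hL => l _ _ _; exact: bil0l. Qed.

Lemma jac_sum0l x : S 0 x = 0.
Proof. by apply: jac_sum_commuting; case: hL => _ r _ _; exact: bil0r. Qed.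

(** The morphism sending [v] to [v + eps [z, v]] exhibits [[z, S x y]] as a value of the
    differential of [S], known from [jac_sum_dual]. *)
Lemma jac_sum_ad x y z :
  br (S x y) z = iter p (br (x + y)) z - iter p (br x) z - iter p (br y) z.
Proof.
case: (hL) => l r _ _.
have fl : linear (fun v : g => (v, br z v)).
  by move=> a v w; congr (_, _); rewrite (bilDr r) (bilZr r).
have f_br v w : lin_of fl (br v w) = dual_br br (lin_of fl v) (lin_of fl w).
  by rewrite /dual_br /= (lie_leibniz hL) addrC.
rewrite (lieC hL); have /(congr1 snd) /= := jac_sum_morph f_br p x y.
rewrite jac_sum_dual // => ->.
have H u : iter p (br u) z = - iter p.-1 (br u) (br z u).
  by rewrite -[in LHS](prednK p_gt0) iterSr (lieC hL u) -scaleN1r (bil_iterZ r) scaleN1r.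
by rewrite !H (bilDr r) !opprK !opprD !opprK.
Qed.

(** Evaluation respects brackets only when degrees are tracked, so the iterates are followed by
    induction instead of [jac_sum_morph]. *)
Lemma form_eval_jac_sum a b x1 x0 y1 y0 :
  let SG := jac_sum p (PB : (nat -> g) -> _ -> _) (poly_lin x1 x0) (poly_lin y1 y0) in
  deg_le p SG /\ form_eval a b p SG = S (a *: x1 + b *: x0) (a *: y1 + b *: y0).
Proof.
case: (hL) => l r _ _ /=; rewrite -!form_eval_lin.
set X := poly_lin x1 x0; set Y := poly_lin y1 y0.
(* The outer index belongs to the variable of the Jacobson polynomial, the inner one to the
   parameter of the path. *)
pose I n : nat -> nat -> g := iter n (ad (poly_bracket (g := nat -> g) PB)
  (poly_lin (g := nat -> g) X Y)) (poly_cst (g := nat -> g) X).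
pose F d := lin_of (form_eval_linear a b d : linear (form_eval (g := g) a b d)).
have F0 d : form_eval a b d 0 = 0 :> g := linear0 (F d).
have Fsum d (J : Type) (s : seq J) (u : J -> nat -> g) :
    form_eval a b d (\sum_(j <- s) u j) = \sum_(j <- s) form_eval a b d (u j).
  exact: (linear_sum (F d)).
have FZ d c (u : nat -> g) : form_eval a b d (c *: u) = c *: form_eval a b d u.
  exact: (linearZ_LR (F d)).
have dX : deg_le 1 X by apply: deg_le_lin.
have dY : deg_le 1 Y by apply: deg_le_lin.
have dL j : deg_le 1 (poly_lin (g := nat -> g) X Y j) by case: j => [|[]].
have eL j : form_eval a b 1 (poly_lin (g := nat -> g) X Y j) =
    poly_lin (form_eval a b 1 X) (form_eval a b 1 Y) j by case: j => [|[]].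
have deg_sum d (J : Type) (s : seq J) (u : J -> nat -> g) :
    (forall j, deg_le d (u j)) -> deg_le d (\sum_(j <- s) u j).
  by move=> du n dn; rewrite fct_sumE big1 // => j _; exact: du.
have IP n i : deg_le n.+1 (I n i) /\ form_eval a b n.+1 (I n i) =
    iter n (ad PB (poly_lin (form_eval a b 1 X) (form_eval a b 1 Y)))
      (poly_cst (form_eval a b 1 X)) i.
  elim: n i => [|n IH] i; first by case: i.
  rewrite {1 2}/I /= -/(I n) /ad {1 3}/poly_bracket; split.
    apply: deg_sum => j; apply: (@deg_le_bracket _ _ _ l r 1 n.+1) => //.
    by case: (IH (i - j)%N).
  rewrite Fsum; apply: eq_bigr => j _ /=.
  have [dI eI] := IH (i - j)%N.
  by rewrite (@form_eval_bracket _ _ _ l r a b 1 n.+1) // eI eL.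
have IPp i := IP p.-1 i; rewrite (prednK p_gt0) in IPp.
split.
  apply: deg_sum => i m pm; rewrite /jac_s series_scaleE.
  rewrite -[RHS](scaler0 _ (i%:R : k)^-1); congr (_ *: _).
  by have [dI _] := IPp i.-1; exact: dI.
rewrite Fsum; apply: eq_bigr => i _.
by rewrite /jac_s FZ; congr (_ *: _); case: (IPp i.-1).
Qed.

(* Integrating the derivative of [t |-> S (t x1 + x0) (t y1 + y0)]. *)
Lemma jac_sum_integral x1 x0 y1 y0 :
  S (x1 + x0) (y1 + y0) - S x1 y1 - S x0 y0 =
  \sum_(1 <= i < p) (i%:R : k)^-1 *:
    (iter p.-1 (PB (poly_lin (x1 + y1) (x0 + y0))) (poly_cst (x1 + y1))
     - iter p.-1 (PB (poly_lin x1 x0)) (poly_cst x1)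
     - iter p.-1 (PB (poly_lin y1 y0)) (poly_cst y1) : nat -> g) i.-1.
Proof.
case: (hL) => l r _ _.
pose SG := jac_sum p (PB : (nat -> g) -> _ -> _) (poly_lin x1 x0) (poly_lin y1 y0).
have [dS _] := form_eval_jac_sum 0 0 x1 x0 y1 y0; rewrite -/SG in dS.
have eS a b : form_eval a b p SG = S (a *: x1 + b *: x0) (a *: y1 + b *: y0).
  by case: (form_eval_jac_sum a b x1 x0 y1 y0).
have := form_eval_deriv hp dS; rewrite !eS !scale1r !scale0r !addr0 !add0r => <-.
(* As differentiation is a derivation, this is a morphism; its second component at [SG] is the
   derivative to be integrated. *)
have fl : linear (fun v : nat -> g => (v, series_deriv v)).
  by move=> a v w; congr (_, _); rewrite series_deriv_linear.
have f_br v w : lin_of fl (PB v w) = dual_br PB (lin_of fl v) (lin_of fl w).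
  by rewrite /dual_br /= (series_deriv_bracket l r) addrC.
have /(congr1 snd) /= := jac_sum_morph f_br p (poly_lin x1 x0) (poly_lin y1 y0).
rewrite jac_sum_dual; last exact: poly_bracket_lie.
rewrite -/SG !series_deriv_lin => ->.
have -> : poly_lin x1 x0 + poly_lin y1 y0 = poly_lin (x1 + y1) (x0 + y0).
  by apply/funext => -[|[|n]] //=; rewrite series_addE /= addr0.
have -> // : poly_cst x1 + poly_cst y1 = poly_cst (x1 + y1).
by apply/funext => -[|n] //=; rewrite series_addE /= addr0.
Qed.

Lemma jac_sum_series x y :
  \sum_(1 <= i < p) (i%:R : k)^-1 *:
    iter p.-1 (PB (poly_lin x y)) (poly_cst x) i.-1 = S x y.
Proof. by []. Qed.

(** Integration along the path [(t x + y, z)]: the three integrals are [S x (y + z)], [S x y] and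
    0. *)
Lemma jac_sum_cocycle x y z : S x y + S (x + y) z = S y z + S x (y + z).
Proof.
have := jac_sum_integral x y 0 z; rewrite jac_sum0r subr0 add0r addr0.
rewrite (_ : iter _ _ (poly_cst 0) = 0) ?subr0; last first.
  rewrite (_ : poly_cst 0 = 0); last by apply/funext => -[].
  by apply: bil_iter0; apply: poly_bracket_linr; case: hL.
under eq_bigr => i _ do rewrite series_addE scalerDr scalerN.
rewrite big_split /= sumrN !jac_sum_series => /eqP.
by rewrite subr_eq => /eqP ->; rewrite addrA [S x y + (_ - _)]addrC addrNK addrC.
Qed.

(** Integration along the path [(y, t x)]: all integrals but [S x y] vanish. *)
Lemma jac_sumC x y : S x y = S y x.
Proof.
have := jac_sum_integral 0 y x 0; rewrite jac_sum0l jac_sum0r !subr0 !add0r !addr0.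
under eq_bigr => i _ do rewrite !series_addE !scalerDr !scalerN.
rewrite !big_split /= !sumrN !jac_sum_series.
by rewrite jac_sum0l jac_sum0r !subr0 => ->.
Qed.

End Jacobson.


(** * Linear extension from a basis *)

Section LinComb.
Variables (k : fieldType) (g : lmodType k) (J : Type) (e : J -> g).

(** Indices may repeat, so that addition is concatenation. *)
Definition lin_comb (V : lmodType k) (v : J -> V) (l : seq (k * J)) : V :=
  \sum_(q <- l) q.1 *: v q.2.

Lemma lin_comb_cat (V : lmodType k) (v : J -> V) l1 l2 :
  lin_comb v (l1 ++ l2) = lin_comb v l1 + lin_comb v l2.
Proof. exact: big_cat. Qed.

Lemma lin_comb_scale (V : lmodType k) (v : J -> V) a l :
  lin_comb v [seq (a * q.1, q.2) | q <- l] = a *: lin_comb v l.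
Proof.
by rewrite /lin_comb big_map scaler_sumr; apply: eq_bigr => q _; rewrite scalerA.
Qed.

Lemma spanning_comb : spanning e -> forall x, exists l, x = lin_comb e l.
Proof.
move=> sp x; have [n [f [c ->]]] := sp x.
by exists [seq (c i, f i) | i <- index_enum 'I_n]; rewrite /lin_comb big_map.
Qed.

Lemma spanning_ind (P : g -> Prop) : spanning e -> P 0 ->
  (forall j, P (e j)) -> (forall a x, P x -> P (a *: x)) ->
  (forall x y, P x -> P y -> P (x + y)) -> forall x, P x.
Proof.
move=> sp P0 Pe PZ PD x; have [l ->] := spanning_comb sp x.
by apply: big_ind => // q _; apply: PZ.
Qed.

End LinComb.

(** Independence speaks of distinct indices, so the coefficients of each index are first added
    up. *)
Lemma lin_comb_indep (k : fieldType) (g : lmodType k) (J : eqType) (e : J -> g)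
    (V : lmodType k) (v : J -> V) l :
  lin_indep e -> lin_comb e l = 0 -> lin_comb v l = 0.
Proof.
move=> li; pose s : seq J := undup [seq q.2 | q <- l].
pose c (j : J) : k := \sum_(q <- l | q.2 == j) q.1.
have combE (W : lmodType k) (w : J -> W) :
    lin_comb w l = \sum_(i < size s) c (tnth (in_tuple s) i) *: w (tnth (in_tuple s) i).
  transitivity (\sum_(j <- s) c j *: w j); last by rewrite big_tnth.
  under [RHS]eq_bigr => j _ do rewrite scaler_suml.
  rewrite (exchange_big_dep predT) //= /lin_comb big_seq_cond [RHS]big_seq_cond.
  apply: eq_bigr => q /andP[ql _]; rewrite big_mkcond (bigD1_seq q.2) ?undup_uniq //=.
    by rewrite eqxx big1 ?addr0 // => j /negbTE; rewrite eq_sym => ->.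
  by rewrite mem_undup; apply/mapP; exists q.
rewrite !combE => /(li _ _ (fun i => c (tnth (in_tuple s) i))) c0.
rewrite big1 // => i _; rewrite c0 ?scale0r //.
by apply/tuple_uniqP; rewrite /= undup_uniq.
Qed.

Lemma basis_extend (k : fieldType) (g : lmodType k) (J : Type) (e : J -> g)
    (V : lmodType k) (v : J -> V) : is_basis e ->
  exists F : g -> V, linear F /\ forall j, F (e j) = v j.
Proof.
case=> li sp; have /choice[L eL] := spanning_comb sp.
have uniqv l1 l2 : lin_comb e l1 = lin_comb e l2 -> lin_comb v l1 = lin_comb v l2.
  move=> E; apply/eqP; rewrite -subr_eq0; apply/eqP.
  (* Classical logic equips [J] with the equality test that collecting coefficients requires. *)
  have := @lin_comb_indep k g {classic J} e V v
    (l1 ++ [seq (-1 * q.1, q.2) | q <- l2]) li.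
  by rewrite !lin_comb_cat !lin_comb_scale !scaleN1r E subrr => ->.
exists (fun x => lin_comb v (L x)); split.
  move=> a x y; rewrite -lin_comb_scale -lin_comb_cat; apply: uniqv.
  by rewrite lin_comb_cat lin_comb_scale -!eL.
move=> j; have E (W : lmodType k) (w : J -> W) : lin_comb w [:: (1, j)] = w j.
  by rewrite /lin_comb big_seq1 scale1r.
by rewrite -[RHS]E; apply: uniqv; rewrite -eL E.
Qed.

(** * The extension of [g] by its Frobenius twist *)

Section FrobeniusExtension.
Variables (k : fieldType) (p : nat) (g : lmodType k) (br : g -> g -> g).
Hypothesis hp : p \in [pchar k].
Hypothesis hL : is_lie_bracket br.

Let linl := lie_linear_l hL.
Let linr := lie_linear_r hL.
Let alt := lie_alt hL.
Let p_gt0 : (0 < p)%N. Proof. exact: prime_gt0 (pcharf_prime hp). Qed.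

(** The iterated bracket contributes [p.-1] factors [a], its argument one more. *)
Lemma jac_sumZ a x y : jac_sum p br (a *: x) (a *: y) = a ^+ p *: jac_sum p br x y.
Proof.
rewrite scaler_sumr; apply: eq_bigr => i _.
rewrite /jac_s [RHS]scalerA [_ * _^-1]mulrC -scalerA; congr (_ *: _).
rewrite (_ : poly_lin (a *: x) (a *: y) = a *: poly_lin x y); last first.
  by apply/funext => -[|[|n]]; rewrite series_scaleE /= ?scaler0.
rewrite (_ : poly_cst (a *: x) = a *: poly_cst x); last first.
  by apply/funext => -[|n]; rewrite series_scaleE /= ?scaler0.
rewrite (bil_iterZl (poly_bracket_linl linl) (poly_bracket_linr linr)).
rewrite (bil_iterZ (poly_bracket_linr linr)) scalerA -exprSr prednK //.
Qed.

(* The extension of [g] by its Frobenius twist with cocycle [jac_sum]: the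
   p-maps for [br] are, up to the condition on [ad], the linear sections of
   its first projection. *)
Definition frob_ext (_ : p \in [pchar k]) (_ : is_lie_bracket br) : Type :=
  (g * g)%type.

Local Notation E := (frob_ext hp hL).

HB.instance Definition _ := Choice.copy E (g * g)%type.

(** The cocycle identity gives associativity, symmetry gives commutativity, and vanishing on lines
    lets [frob_opp] do without a correction term. *)
Definition frob_add (X Y : E) : E :=
  (X.1 + Y.1, X.2 + Y.2 + jac_sum p br X.1 Y.1).
Definition frob_opp (X : E) : E := (- X.1, - X.2).
Definition frob_scale (a : k) (X : E) : E := (a *: X.1, a ^+ p *: X.2).

Lemma jac_sum_line a b x : jac_sum p br (a *: x) (b *: x) = 0.
Proof.
by apply: (jac_sum_commuting hp hL); rewrite (bilZl linl) (bilZr linr) alt !scaler0.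
Qed.

Lemma frob_addA : associative frob_add.
Proof.
move=> [x u] [y v] [z w]; congr (_, _) => /=; first by rewrite addrA.
rewrite !addrA -!addrA; congr (u + (v + _)).
by rewrite ![_ + (w + _)]addrCA; congr (w + _); rewrite -(jac_sum_cocycle hp hL).
Qed.

Lemma frob_addC : commutative frob_add.
Proof.
move=> [x u] [y v]; congr (_, _) => /=; first by rewrite addrC.
by rewrite [u + v]addrC (jac_sumC hp hL).
Qed.

Lemma frob_add0 : left_id ((0, 0) : E) frob_add.
Proof. by case=> x u; rewrite /frob_add /= !add0r (jac_sum0l hp hL) addr0. Qed.

Lemma frob_addN : left_inverse ((0, 0) : E) frob_opp frob_add.
Proof.
case=> x u; rewrite /frob_add /frob_opp /= !addNr add0r; congr (_, _).
by rewrite -[x in jac_sum _ _ _ x]scale1r -scaleN1r jac_sum_line.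
Qed.

HB.instance Definition _ :=
  GRing.isZmodule.Build E frob_addA frob_addC frob_add0 frob_addN.

Lemma frob_scaleA a b (X : E) : frob_scale a (frob_scale b X) = frob_scale (a * b) X.
Proof. by rewrite /frob_scale /= !scalerA exprMn. Qed.

Lemma frob_scale1 : left_id 1 frob_scale.
Proof. by case=> x u; rewrite /frob_scale /= expr1n !scale1r. Qed.

Lemma frob_scaleDr : right_distributive frob_scale +%R.
Proof.
move=> a [x u] [y v]; congr (_, _) => /=; first by rewrite scalerDr.
by rewrite !scalerDr jac_sumZ.
Qed.

Lemma frob_scaleDl (X : E) : {morph frob_scale^~ X : a b / a + b}.
Proof.
case: X => x u a b; congr (_, _) => /=; first by rewrite scalerDl.
rewrite jac_sum_line addr0 -scalerDl -!(pFrobenius_autE hp).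
by rewrite pFrobenius_autD_comm //; apply: mulrC.
Qed.

HB.instance Definition _ :=
  GRing.Zmodule_isLmodule.Build k E frob_scaleA frob_scale1 frob_scaleDr frob_scaleDl.

End FrobeniusExtension.

(** * Existence and uniqueness of p-maps *)

Section PMap.
Variables (k : fieldType) (p : nat) (g : lmodType k) (br : g -> g -> g).
Hypothesis hp : p \in [pchar k].
Hypothesis hL : is_lie_bracket br.
Variables (J : Type) (e : J -> g) (y : J -> g).

Lemma pmap0 pm : is_pmap p br pm -> pm 0 = 0.
Proof.
case=> Z _ _; rewrite -[0 in LHS](scale0r 0) Z expr0n.
by rewrite eqn0Ngt (prime_gt0 (pcharf_prime hp)) scale0r.
Qed.

(** Both maps have the same Jacobson correction, so agreement is stable under sums. *)
Lemma pmap_eq pm1 pm2 : spanning e -> is_pmap p br pm1 -> is_pmap p br pm2 ->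
  (forall j, pm1 (e j) = pm2 (e j)) -> pm1 = pm2.
Proof.
move=> sp h1 h2 E; apply/funext; apply: (spanning_ind sp) => //.
- by rewrite !pmap0.
- by move=> a x IH; rewrite (pmapZ h1) (pmapZ h2) IH.
- by move=> x x' IH IH'; rewrite (pmapD h1) (pmapD h2) IH IH'.
Qed.

Lemma pmap_exists : is_basis e ->
  (forall j, iter p (ad br (e j)) =1 ad br (y j)) ->
  exists pm, is_pmap p br pm /\ forall j, pm (e j) = y j.
Proof.
move=> he hy; case: (hL) => l r _ _; have [_ sp] := he.
have p_gt0 := prime_gt0 (pcharf_prime hp).
(* [F] is a linear section of the extension, and its second component is the p-map. *)
have [F [Flin Fe]] := basis_extend (fun j => (e j, y j) : frob_ext hp hL) he.
have FD x x' : F (x + x') = F x + F x' by have := Flin 1 x x'; rewrite !scale1r.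
have F0 : F 0 = 0 by apply: (addrI (F 0)); rewrite -FD !addr0.
have FZ a x : F (a *: x) = a *: F x by have := Flin a x 0; rewrite !addr0 F0 addr0.
have F1 x : (F x).1 = x.
  move: x; apply: (spanning_ind sp); first by rewrite F0.
  - by move=> j; rewrite Fe.
  - by move=> a x E; rewrite FZ /= E.
  - by move=> x x' E E'; rewrite FD /= E E'.
have F2Z a x : (F (a *: x)).2 = a ^+ p *: (F x).2 by rewrite FZ.
have F2D x x' : (F (x + x')).2 = (F x).2 + (F x').2 + jac_sum p br x x'.
  by rewrite FD /= !F1.
exists (fun x => (F x).2); split; last by move=> j; rewrite Fe.
(* By [jac_sum_ad], the condition on [ad] is stable under sums and can be checked on the basis. *)
split=> //; apply: (spanning_ind sp).
- by move=> z; rewrite F0 /= (bil0l l) -[p in iter p](prednK p_gt0) /= /ad (bil0l l).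
- by move=> j z; rewrite Fe hy.
- by move=> a x IH z; rewrite F2Z (bilZl l) IH /ad (bil_iterZl l r).
- move=> x x' IH IH' z; rewrite F2D !(bilDl l) IH IH' (jac_sum_ad hp hL) /ad.
  by rewrite -[_ - _ - _]addrA -opprD addrCA subrr addr0.
Qed.

End PMap.


(** * The sum over compositions as a coefficient of an iterated bracket *)

Section Compositions.
Variables (k : fieldType) (g : lmodType k) (br : g -> g -> g).
Hypothesis hL : is_lie_bracket br.
Variables (x z : g).

Let linl := lie_linear_l hL.
Let linr := lie_linear_r hL.

Local Notation w := (fun a => iter a.-1 (br z) x).

(* [comp_coef] for blocks preceded by blocks of total size [m]. *)
Fixpoint comp_coef_from (m : nat) (s : seq nat) : nat :=
  if s is a :: s' then ('C((m + a).-1, a.-1) * comp_coef_from (m + a) s')%N else 1%N.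

Lemma comp_coef_fromE m s : comp_coef_from m s =
  (\prod_(i < size s) 'C((m + sumn (take i.+1 s)).-1, (nth 0 s i).-1))%N.
Proof.
elim: s m => [|a s IH] m; first by rewrite big_ord0.
rewrite /= big_ord_recl /= take0 /= addn0 IH; congr (_ * _)%N.
by apply: eq_bigr => i _; rewrite addnA.
Qed.

(* The sum of [comp_coef_from m a *: [w a_1, [w a_2, ..]]] over the
   compositions [a] of [n] of length [r.+1]. *)
Fixpoint comp_sum (r n m : nat) : g :=
  if r is r'.+1 then
    \sum_(b < n) 'C(m + b, b)%:R *:
      br (iter b (br z) x) (comp_sum r' (n - b.+1) (m + b.+1))
  else if n is b.+1 then 'C(m + b, b)%:R *: iter b (br z) x else 0.

Lemma comp_sum0 r m : comp_sum r 0 m = 0.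
Proof. by case: r => //= r; rewrite big_ord0. Qed.

(** Induction on the length, with Pascal's rule for the first coefficient and the Leibniz rule for
    [br z]. *)
Lemma comp_sumS r n m :
  comp_sum r n.+1 m.+1 = comp_sum r n.+1 m + br z (comp_sum r n m.+1).
Proof.
elim: r n m => [|r IH] n m /=.
  rewrite addSn; case: n => [|n]; first by rewrite !bin0 (bil0r linr) addr0.
  by rewrite binS natrD scalerDl (bilZr linr) addSnnS.
(* The induction hypothesis splits each inner sum: [Y] has the lowered offset, [Z] an inner
   [br z]. *)
pose T := comp_sum r; pose Y b := br (iter b (br z) x) (T (n - b)%N (m + b.+1)%N).
pose Z b := br (iter b (br z) x) (br z (T (n - b.+1)%N (m.+1 + b.+1)%N)).
have YZ b : (b < n)%N ->
    br (iter b (br z) x) (T (n - b)%N (m.+1 + b.+1)%N) = Y b + Z b.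
  by move=> bn; rewrite /Y /Z /T -(subnSK bn) addSn IH (bilDr linr).
have Yn : Y n = 0 by rewrite /Y subnn /T comp_sum0 (bil0r linr).
transitivity (\sum_(b < n) 'C(m.+1 + b, b)%:R *: (Y b + Z b)).
  rewrite big_ord_recr /= !subSS subnn comp_sum0 (bil0r linr) scaler0 addr0.
  by apply: eq_bigr => -[b bn] _ /=; rewrite subSS YZ.
transitivity (\sum_(b < n.+1) 'C(m + b, b)%:R *: Y b +
    \sum_(b < n) 'C(m.+1 + b, b)%:R *: (Y b.+1 + Z b)); last first.
  congr (_ + _); rewrite (bil_sumr linr); apply: eq_bigr => b _.
  by rewrite (bilZr linr) (lie_leibniz hL) /Y /Z /T !addSn !addnS.
under eq_bigr => b _ do rewrite scalerDr.
under [X in _ = _ + X]eq_bigr => b _ do rewrite scalerDr.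
rewrite !big_split /= addrA; congr (_ + _).
transitivity (\sum_(b < n.+1) 'C(m.+1 + b, b)%:R *: Y b).
  by rewrite big_ord_recr /= Yn scaler0 addr0.
rewrite !big_ord_recl /= !bin0 -addrA; congr (_ + _); rewrite -big_split /=.
by apply: eq_bigr => b _; rewrite /bump /= -scalerDl -natrD !addSn !addnS binS addnC.
Qed.

(** This is the recurrence of the coefficients under [ad (t x + z)]: [x] raises both the power of
    [t] and the number of blocks, [z] neither. *)
Lemma comp_sumS0 r n :
  comp_sum r.+1 n.+1 0 = br x (comp_sum r n 0) + br z (comp_sum r.+1 n 0).
Proof.
pose T := comp_sum r; pose Y b := br (iter b (br z) x) (T (n - b)%N b).
pose Z b := br (iter b (br z) x) (br z (T (n - b.+1)%N b.+1)).
have Yn : Y n = 0 by rewrite /Y subnn /T comp_sum0 (bil0r linr).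
transitivity (\sum_(b < n) (Y b + Z b)).
  rewrite /= big_ord_recr /= !subSS subnn comp_sum0 (bil0r linr) scaler0 addr0.
  apply: eq_bigr => -[b bn] _ /=; rewrite !add0n binn scale1r subSS.
  by rewrite /Y /Z /T -(bilDr linr) -(subnSK bn) comp_sumS.
transitivity (Y 0 + \sum_(b < n) (Y b.+1 + Z b)); last first.
  rewrite /Y subn0; congr (_ + _); rewrite (bil_sumr linr); apply: eq_bigr => b _.
  by rewrite !add0n binn scale1r (lie_leibniz hL).
rewrite !big_split /= addrA; congr (_ + _).
transitivity (\sum_(b < n.+1) Y b); first by rewrite big_ord_recr /= Yn addr0.
by rewrite big_ord_recl.
Qed.

(** The argument [x] counts too, hence total size [n.+1] and [r.+1] blocks. *)
Lemma iter_comp_sum n r :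
  iter n (poly_bracket br (poly_lin x z)) (poly_cst x) r = comp_sum r n.+1 0.
Proof.
elim: n r => [|n IH] r.
  case: r => [|r] /=; first by rewrite bin0 scale1r.
  by rewrite big_ord_recl big_ord0 comp_sum0 (bil0r linr) scaler0 addr0.
rewrite iterS {1}/poly_bracket; case: r => [|r].
  by rewrite big_ord_recl big_ord0 IH /= !add0n !binn !scale1r addr0.
rewrite comp_sumS0 -!IH !big_ord_recl /= big1 ?addr0 => [|i _].
  by rewrite subn0 /bump /= subn1 addrC.
exact: (bil0l linl).
Qed.

Lemma big_tuple_cons (V : nmodType) (T : finType) r (P : pred (seq T))
    (F : seq T -> V) :
  \sum_(a : r.+1.-tuple T | P a) F a =
  \sum_i \sum_(b : r.-tuple T | P (i :: b)) F (i :: b).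
Proof.
rewrite pair_big_dep /= (reindex (fun q : T * r.-tuple T => cons_tuple q.1 q.2)) //.
exists (fun a => (thead a, behead_tuple a)) => [[i b] _|a _] /=.
  by congr (_, _); apply: val_inj.
by rewrite [RHS]tuple_eta; apply: val_inj.
Qed.

Lemma nested_bracket_cons (y : g) s : s != [::] ->
  nested_bracket br (y :: s) = br y (nested_bracket br s).
Proof. by case: s. Qed.

(** [N] stays fixed while [n] decreases, so that the type of the parts is constant in the
    recursion. *)
Lemma tuple_comp_sum N r n m : (n <= N)%N ->
  \sum_(a : r.+1.-tuple 'I_N.+1 | is_composition n (map val a))
     (comp_coef_from m (map val a))%:R *:
       nested_bracket br [seq w (val i) | i <- a] = comp_sum r n m.
Proof.
move=> nN; pose F (a : seq 'I_N.+1) := (comp_coef_from m (map val a))%:R *: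
  nested_bracket br [seq w (val i) | i <- a].
elim: r n m nN @F => [|r IH] n m nN F.
  rewrite (big_tuple_cons _ (fun a => is_composition n (map val a)) F).
  have compE (i : 'I_N.+1) (b : 0.-tuple 'I_N.+1) :
      is_composition n (val i :: map val b) = (0 < i)%N && (i == n :> nat).
    by rewrite tuple0 /is_composition /= andbT addn0.
  case: n nN @F compE => [|n] nN F compE.
    by rewrite big1 // => i _; rewrite big1 // => b; rewrite /= compE; case: (val i).
  pose o := Ordinal (nN : (n.+1 < N.+1)%N).
  rewrite (bigD1 o) //= addrC big1 ?add0r => [|i ni].
    rewrite (big_pred1 [tuple]) => [|b]; last by rewrite (compE o) [b]tuple0 /= !eqxx.
    by rewrite /F /= muln1 addnS.
  rewrite big1 // => b; rewrite /= compE => /andP[_ /eqP E].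
  by case/eqP: ni; apply: val_inj.
rewrite (big_tuple_cons _ (fun a => is_composition n (map val a)) F).
(* A zero first part is excluded; from here on [i] stands for the part [i.+1], as in [comp_sum]. *)
rewrite big_ord_recl big1 ?add0r => [|b]; last by rewrite /is_composition /=.
rewrite /= (big_ord_widen N (fun b => 'C(m + b, b)%:R *:
  br (iter b (br z) x) (comp_sum r (n - b.+1) (m + b.+1)))) // [RHS]big_mkcond /=.
apply: eq_bigr => i _; case: ltnP => [lt_in|le_ni]; last first.
  (* A first part exceeding [n] leaves no composition of [n]. *)
  rewrite big1 // => b; rewrite /is_composition /= /bump /= => /andP[_ /eqP E].
  by have := leq_addr (sumn (map val b)) (1 + i); rewrite E ltnNge le_ni.
rewrite -IH; last by apply: leq_trans nN; apply: leq_subr.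
rewrite (bil_sumr linr) scaler_sumr; apply: eq_big => [b|b _].
  rewrite /is_composition /= /bump /=; congr (_ && _).
  by rewrite -[in RHS](eqn_add2l i.+1) subnKC.
rewrite /F map_cons nested_bracket_cons; last by case: b => -[].
by rewrite /= /bump /= (bilZr linr) scalerA natrM addnS.
Qed.

End Compositions.


(** * The map [rb_pmap] and the compatibility condition *)

Section RotaBaxter.
Variables (k : fieldType) (p : nat) (g : lmodType k) (lambda : k).
Variables (br : g -> g -> g) (R : {linear g -> g}) (pm : g -> g).
Hypothesis hp : p \in [pchar k].
Hypothesis hL : is_lie_bracket br.
Hypothesis hR : is_rota_baxter lambda br R.
Hypothesis hpm : is_pmap p br pm.

Let linl := lie_linear_l hL.
Let linr := lie_linear_r hL.
Let p_gt0 : (0 < p)%N. Proof. exact: prime_gt0 (pcharf_prime hp). Qed.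
Let p_gt1 : (1 < p)%N. Proof. exact: prime_gt1 (pcharf_prime hp). Qed.

Local Notation rb := (rb_pmap p lambda br R pm).

Lemma rb_pmapE x : rb x = lambda ^+ p.-1 *: pm x +
  \sum_(1 <= r < p) lambda ^+ r.-1 *: jac_s p br r x (R x).
Proof.
rewrite /rb_pmap; congr (_ + _); apply: eq_big_nat => -[//|r] _.
rewrite /jac_s /ad (iter_comp_sum hL) (prednK p_gt0) scalerA mulrC; congr (_ *: _).
rewrite -(tuple_comp_sum hL x (R x) r 0 (leqnn p)); apply: eq_bigr => a _.
by congr (_%:R *: _); rewrite comp_coef_fromE.
Qed.

(** The terms [t x] contribute [i.-1] factors [a], the argument [x] one more. *)
Lemma jac_sZl i a x y : (0 < i)%N ->
  jac_s p br i (a *: x) y = a ^+ i *: jac_s p br i x y.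
Proof.
case: i => // i _; rewrite /jac_s [RHS]scalerA [_ * _^-1]mulrC -scalerA; congr (_ *: _).
rewrite /= exprS -scalerA.
rewrite (_ : poly_cst (a *: x) = a *: poly_cst x); last first.
  by apply/funext => -[|n]; rewrite series_scaleE /= ?scaler0.
rewrite (bil_iterZ (poly_bracket_linr linr)) series_scaleE; congr (_ *: _).
rewrite /ad; elim: p.-1 i => [|n IH] i /=.
  by case: i => [|i]; rewrite ?expr0 ?scale1r //= scaler0.
rewrite /poly_bracket scaler_sumr; apply: eq_bigr => -[j Hj] _ /=.
rewrite IH (bilZr linr); case: j Hj => [|[|j]] Hj /=; first by rewrite subn0.
  by rewrite (bilZl linl) scalerA -exprSr subn1 prednK.
by rewrite (bil0l linl) !scaler0.
Qed.

(** By [jac_sZl], the factor [lambda ^+ r] moves into the first argument of [jac_s]; then Jacobson's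
    formula applies. *)
Lemma rb_pmap_scaled x : lambda *: rb x = pm (lambda *: x + R x) - pm (R x).
Proof.
rewrite rb_pmapE scalerDr scalerA -exprS (prednK p_gt0) (pmapD hpm) (pmapZ hpm).
rewrite [RHS]addrAC addrK scaler_sumr; congr (_ + _).
apply: eq_big_nat => i /andP[i_gt0 _].
by rewrite jac_sZl // scalerA -exprS prednK.
Qed.

(** Only [r = 1] survives, which is the constant coefficient in [t]. *)
Lemma rb_pmap_weight0 x : lambda = 0 -> rb x = iter p.-1 (br (R x)) x.
Proof.
move=> l0; rewrite rb_pmapE l0 expr0n.
have -> : (p.-1 == 0)%N = false by rewrite -subn1 subn_eq0 leqNgt p_gt1.
rewrite scale0r add0r big_ltn // big_nat big1 => [|[|[|r]] //]; last first.
  by rewrite expr0n scale0r.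
rewrite addr0 expr0 scale1r /jac_s /= invr1 scale1r.
elim: p.-1 => //= n IH; rewrite {1}/ad /poly_bracket big_ord_recl big_ord0 addr0 /=.
by rewrite IH.
Qed.

Lemma rb_pmapZ a x : rb (a *: x) = a ^+ p *: rb x.
Proof.
have [l0|l0] := eqVneq lambda 0.
  rewrite !rb_pmap_weight0 // linearZ (bil_iterZl linl linr) (bil_iterZ linr).
  by rewrite scalerA -exprSr prednK.
apply: (scalerI l0); rewrite scalerA [_ * _ ^+ _]mulrC -scalerA !rb_pmap_scaled.
by rewrite linearZ_LR scalerA [lambda * _]mulrC -scalerA -scalerDr !(pmapZ hpm) scalerBr.
Qed.

Definition descendent_br (x y : g) : g :=
  br (R x) y + br x (R y) + lambda *: br x y.

Lemma descendent_br_morph x y : R (descendent_br x y) = br (R x) (R y).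
Proof. by rewrite hR !linearD linearZ_LR. Qed.

(* For nonzero weight both [R] and [R + lambda] are morphisms out of the
   descendent algebra and [lambda rb = pm \o (R + lambda) - pm \o R]; for
   weight zero [x |-> R x + eps x] is such a morphism to g[eps]. *)
Lemma rb_pmapD x y : rb (x + y) = rb x + rb y + jac_sum p descendent_br x y.
Proof.
have [l0|l0] := eqVneq lambda 0.
  have fl : linear (fun v : g => (R v, v)) by move=> a v w; rewrite linearP.
  have f_br v w : lin_of fl (descendent_br v w) =
      dual_br br (lin_of fl v) (lin_of fl w).
    congr (_, _); first exact: descendent_br_morph.
    by rewrite /= /descendent_br l0 scale0r addr0.
  have /(congr1 snd) /= -> := jac_sum_morph f_br p x y.
  rewrite (jac_sum_dual hp) // !rb_pmap_weight0 // linearD.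
  by rewrite -[_ - _ - _]addrA -opprD addrCA subrr addr0.
apply: (scalerI l0).
have fl : linear (fun v : g => lambda *: v + R v).
  move=> a v w; rewrite linearP !scalerDr addrACA; congr (_ + _ + _).
  by rewrite !scalerA mulrC.
have f_br v w : lin_of fl (descendent_br v w) = br (lin_of fl v) (lin_of fl w).
  rewrite /= descendent_br_morph (bilDl linl) !(bilDr linr) !(bilZl linl) !(bilZr linr).
  rewrite /descendent_br !scalerDr !scalerA addrA; congr (_ + _).
  by rewrite [LHS]addrC [X in _ + X = _]addrC addrA.
(* Naturality along [lambda + R] minus naturality along [R]. *)
have E : lambda *: jac_sum p descendent_br x y =
    jac_sum p br (lambda *: x + R x) (lambda *: y + R y) - jac_sum p br (R x) (R y).
  have /= <- := jac_sum_morph f_br p x y.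
  by rewrite -(jac_sum_morph descendent_br_morph) addrK.
rewrite [RHS]scalerDr [X in _ = X + _]scalerDr E !rb_pmap_scaled.
have -> : lambda *: (x + y) + R (x + y) = (lambda *: x + R x) + (lambda *: y + R y).
  by rewrite scalerDr linearD addrACA.
rewrite [R (x + y)]linearD !(pmapD hpm).
by rewrite [X in _ = X + _]addrACA -opprD [RHS]addrACA -opprD.
Qed.

(** [R] carries the Jacobson correction of [rb], taken in [descendent_br], to that of [pm] in
    [br]. *)
Lemma rb_compat_extend (J : Type) (e : J -> g) : spanning e ->
  (forall j, R (rb (e j)) = pm (R (e j))) -> forall x, R (rb x) = pm (R x).
Proof.
move=> sp He; apply: (spanning_ind sp) => //.
- have E x : R (rb (0 *: x)) = pm (R (0 *: x)).
    rewrite rb_pmapZ !linearZ_LR (pmapZ hpm) expr0n eqn0Ngt p_gt0 /=.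
    by rewrite !scale0r.
  by have := E 0; rewrite scale0r.
- by move=> a x E; rewrite rb_pmapZ !linearZ_LR (pmapZ hpm) E.
- move=> x y Ex Ey; rewrite rb_pmapD [LHS]linearD [X in X + _ = _]linearD Ex Ey.
  rewrite [R (x + y)]linearD (pmapD hpm).
  by rewrite (jac_sum_morph descendent_br_morph).
Qed.

End RotaBaxter.

Theorem theorem4p11 (k : closedFieldType) (p : nat) (hp : p \in [pchar k])
    (g : lmodType k) (lambda : k) (br : g -> g -> g) (R : {linear g -> g})
    (hg : is_rota_baxter_lie lambda br R)
    (J : Type) (e : J -> g) (he : is_basis e)
    (y : J -> g) (hy : forall j, iter p (ad br (e j)) =1 ad br (y j)) :
  (exists! pm : g -> g,
     is_restricted_lie p br pm /\ (forall j, pm (e j) = y j)) /\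
  (forall pm : g -> g,
     is_restricted_lie p br pm -> (forall j, pm (e j) = y j) ->
     (forall j, R (rb_pmap p lambda br R pm (e j)) = pm (R (e j))) ->
     is_restricted_rota_baxter_lie p lambda br pm R).
Proof.
have [hL hR] := hg; have [_ sp] := he; split.
  have [pm [hpm pme]] := pmap_exists hp hL he hy.
  exists pm; split=> // pm' [[_ hpm'] pme']; apply: (pmap_eq hp sp hpm hpm') => j.
  by rewrite pme pme'.
move=> pm [_ hpm] _ He; split=> //.
exact: (rb_compat_extend hp hL hR hpm sp He).
Qed.
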